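(* Every Y-family $F(k;r,s)$ has two incomparable Gale-maximal members, namely the tops of its two arms, $[k-1]\cup\{r\}$ and $[k+1]\setminus\{s\}$. Consequently a shifted family of $k$-subsets of $[n]$ ($1\le k\le n$) that has a Gale-greatest member is never a Y-family, and its Johnson graph is Hamilton-connected.
   Context: $[n]=\{1,\dots,n\}$. The Gale order on $k$-subsets of $[n]$: for $X=\{x_1<\dots<x_k\}$ and $Y=\{y_1<\dots<y_k\}$, $X\preceq Y$ iff $x_i\le y_i$ for all $i$. A family $F$ of $k$-subsets of $[n]$ is shifted if it is nonempty and whenever $X\in F$, $j\in X$, $i<j$, $i\notin X$, also $(X\setminus\{j\})\cup\{i\}\in F$ (equivalently, $F$ is a nonempty down-set of the Gale order). A Gale-greatest member of $F$ is $M\in F$ with $Z\preceq M$ for all $Z\in F$; Gale-maximal means maximal in $F$ under $\preceq$. The Johnson graph $J(F)$ has vertex set $F$, with $X,Y$ adjacent iff $|X\triangle Y|=2$. A graph is Hamilton-connected if every two distinct vertices are the endpoints of a Hamilton path. For $k\ge 2$ and integers $r,s$ with $k+2\le r\le n$ and $1\le s\le k-1$, put $$F(k;r,s)=\{[k],\,[k-1]\cup\{k+1\}\}\cup P\cup Q,$$ with outer arm $P=\{[k-1]\cup\{a\}: k+2\le a\le r\}$ and inner arm $Q=\{[k+1]\setminus\{i\}: s\le i\le k-1\}$. A Y-family is a family of this form. Each arm is a chain in the Gale order and its top is its Gale-greatest element. *)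

(* Defs.v *)
From mathcomp Require Export all_boot.

Set Implicit Arguments.
Unset Strict Implicit.
Unset Printing Implicit Defensive.

(* The ground set [n] = {1, ..., n} is 'I_n, the ordinal i standing for the
   integer i.+1. *)
Definition lab (n : nat) (i : 'I_n) : nat := i.+1.

(* The initial segment [m], as a subset of [n] (truncated to [n] if m > n). *)
Definition seg (n m : nat) : {set 'I_n} := [set i : 'I_n | lab i <= m].

(* The singleton {m}, as a subset of [n] (empty unless 1 <= m <= n). *)
Definition single (n m : nat) : {set 'I_n} := [set i : 'I_n | lab i == m].

(* enum lists a set of ordinals in increasing order, and all2 compares the
   lists entrywise (it is false on lists of different sizes). *)
Definition gale (n : nat) (X Y : {set 'I_n}) : bool :=
  all2 (fun x y : 'I_n => lab x <= lab y) (enum X) (enum Y).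

Definition gale_incomparable (n : nat) (X Y : {set 'I_n}) : Prop := ~~ gale X Y /\ ~~ gale Y X.

Definition gale_greatest (n : nat) (F : {set {set 'I_n}}) (M : {set 'I_n}) : Prop :=
  M \in F /\ forall Z, Z \in F -> gale Z M.

Definition gale_maximal (n : nat) (F : {set {set 'I_n}}) (M : {set 'I_n}) : Prop :=
  M \in F /\ forall Z, Z \in F -> gale M Z -> Z = M.

Definition uniform (n k : nat) (F : {set {set 'I_n}}) : Prop :=
  forall X, X \in F -> #|X| = k.

Definition shifted (n : nat) (F : {set {set 'I_n}}) : Prop :=
  F != set0 /\
  forall X (i j : 'I_n), X \in F -> j \in X -> lab i < lab j -> i \notin X ->
    i |: (X :\ j) \in F.

Definition johnson_adj (n : nat) : rel {set 'I_n} :=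
  fun X Y => #|(X :\: Y) :|: (Y :\: X)| == 2.

(* Hamilton-connectedness of the graph with vertex set V and adjacency e
   (restricted to V). *)
Definition hamilton_path (T : finType) (V : {set T}) (e : rel T)
    (x y : T) (p : seq T) : Prop :=
  [/\ path e x p, last x p = y, uniq (x :: p) & x :: p =i V].

Definition hamilton_connected (T : finType) (V : {set T}) (e : rel T) : Prop :=
  forall x y : T, x \in V -> y \in V -> x != y ->
    exists p : seq T, hamilton_path V e x y p.

Definition johnson_hamilton_connected (n : nat) (F : {set {set 'I_n}}) : Prop :=
  hamilton_connected F (@johnson_adj n).

(* [k-1] U {a} and [k+1] \ {i} *)
Definition outer_elt (n k a : nat) : {set 'I_n} := seg n k.-1 :|: single n a.
Definition inner_elt (n k i : nat) : {set 'I_n} := seg n k.+1 :\: single n i.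

Definition outer_arm (n k r : nat) : {set {set 'I_n}} :=
  [set outer_elt n k (lab a) | a : 'I_n & k + 2 <= lab a <= r].

Definition inner_arm (n k s : nat) : {set {set 'I_n}} :=
  [set inner_elt n k (lab i) | i : 'I_n & s <= lab i <= k.-1].

Definition Yfam (n k r s : nat) : {set {set 'I_n}} :=
  [set seg n k; outer_elt n k k.+1] :|: outer_arm n k r :|: inner_arm n k s.

Definition Yparams (n k r s : nat) : Prop :=
  [/\ 2 <= k, k + 2 <= r <= n & 1 <= s <= k.-1].

Definition Y_family (n : nat) (F : {set {set 'I_n}}) : Prop :=
  exists k r s : nat, Yparams n k r s /\ F = Yfam n k r s.

(* Main.v *)
Require Import Defs.
From mathcomp Require Import all_boot.
From mathcomp Require Import zify.

Set Implicit Arguments.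
Unset Strict Implicit.
Unset Printing Implicit Defensive.

(** Hamilton-connectedness is proved by deletion and contraction of the largest
    element e of the ground set: a family F splits into F0, whose members avoid
    e, and F1, whose members contain e.  Hamilton paths of the two parts are
    glued along edges of the Johnson graph that exchange e for another element
    ([hamilton_connected_glue]).

    The induction needs a class of families closed under both operations.  The
    Gale order compares sizes of tails: X precedes Y iff the two sets have the
    same size and, for every t, X has no more elements than Y from t on
    ([galeP]).  As a shifted family is a down-set ([shifted_down_closed]), one
    with Gale-greatest member M consists of all k-sets whose tails obey the
    bounds given by M ([principal_bounded]).  Letting the bounds f be arbitrary
    numbers makes the class stable: deletion keeps f and contraction lowers it
    by one, so there is no need to describe the greatest members of F0 and F1.

    The gluing succeeds because of three facts ([bounded_hamilton_connected]).
    A member of F1 may exchange e for any smaller absent element, which gives it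
    at least two neighbours in F0 unless k is so close to the size of the ground
    set that all members of F are adjacent.  A member of F0 may exchange its
    maximum for e.  Finally, if this last exchange always gives the same set,
    then F1 consists of that set only.

    For Y-families, the elements of a set and of its complement give short
    obstructions: if X precedes Y, then Y has an element above any given element
    of X, and misses an element below any given one missed by X.  The top r of
    the outer arm and the gap s of the inner arm then make the two tops maximal,
    and two distinct maximal members are incomparable and exclude a greatest
    one. *)

(** * Gluing Hamilton paths *)

Section HamiltonPaths.

Variables (T : finType) (e : rel T).
Hypothesis e_sym : symmetric e.

Implicit Types (V : {set T}) (x y u v : T).

Lemma hamilton_path1 x : hamilton_path [set x] e x x [::].
Proof. by split=> // z; rewrite !inE. Qed.

Lemma hamilton_path_rev V x y p :
  hamilton_path V e x y p -> exists q, hamilton_path V e y x q.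
Proof.
case=> ep <- Up Vp; exists (rev (belast x p)).
have Erev: last x p :: rev (belast x p) = rev (x :: p).
  by rewrite -rev_rcons -lastI.
split.
- by rewrite rev_path (eq_path (e' := e)).
- by case: (p) => //= a p'; rewrite rev_cons last_rcons.
- by rewrite Erev rev_uniq.
- by move=> z; rewrite Erev mem_rev Vp.
Qed.

Lemma hamilton_path_cat V1 V2 x y u v p q :
    [disjoint V1 & V2] -> e u v ->
    hamilton_path V1 e x u p -> hamilton_path V2 e v y q ->
  hamilton_path (V1 :|: V2) e x y (p ++ v :: q).
Proof.
move=> dV euv [ep lp Up Vp] [eq lq Uq Vq]; split.
- by rewrite cat_path ep /= lp euv.
- by rewrite last_cat.
- rewrite -cat_cons cat_uniq Up Uq andbT; apply/hasPn=> z.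
  by rewrite Vq => zV2; rewrite /= Vp (disjointFl dV zV2).
- by move=> z; rewrite -cat_cons mem_cat Vp Vq inE.
Qed.

Lemma hamilton_path_insert V1 V2 x y u v p1 b p2 q :
    [disjoint V1 & V2] -> e (last x p1) u -> e v b ->
    hamilton_path V1 e x y (p1 ++ b :: p2) -> hamilton_path V2 e u v q ->
  hamilton_path (V1 :|: V2) e x y (p1 ++ (u :: q) ++ b :: p2).
Proof.
move=> dV eu ev [ep lp Up Vp] [eq lq Uq Vq].
have Pperm: perm_eq (x :: p1 ++ (u :: q) ++ b :: p2)
                    ((x :: p1 ++ b :: p2) ++ (u :: q)).
  by rewrite -!cat_cons -catA perm_cat2l perm_catC.
split.
- move: ep; rewrite !cat_path /= => /andP[-> /andP[_ ->]].
  by rewrite eu eq lq ev.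
- by move: lp; rewrite !last_cat.
- rewrite (perm_uniq Pperm) cat_uniq Up Uq andbT; apply/hasPn=> z.
  by rewrite Vq => zV2; rewrite /= Vp (disjointFl dV zV2).
- by move=> z; rewrite (perm_mem Pperm) mem_cat Vp Vq inE.
Qed.

Lemma hamilton_connected_clique V :
  {in V &, forall a b, a != b -> e a b} -> hamilton_connected V e.
Proof.
move=> eV x y xV yV xNy.
pose s := x :: rcons (enum (V :\ x :\ y)) y.
have Us: uniq s.
  by rewrite /s /= rcons_uniq mem_rcons !inE !mem_enum !inE enum_uniq !eqxx
             /= andbF (negbTE xNy).
have Vs: s =i V.
  move=> z; rewrite !inE mem_rcons !inE mem_enum !inE.
  by case: eqP => [->|]; case: eqP => [->|].
exists (behead s); split=> //; last by rewrite last_rcons.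
suff ePw: pairwise e s.
  move: ePw; rewrite /s /=; set p := rcons _ _.
  by move=> /(@pairwise_sorted _ e (x :: p)).
apply: (sub_in_pairwise (P := [in V]) (r := fun a b => a != b)) => //.
  by apply/allP=> z; rewrite Vs.
by rewrite -uniq_pairwise.
Qed.

Lemma color_change (U : eqType) (g : T -> U) x p :
    ~~ all (fun z => g z == g x) p ->
  exists p1 b p2, p = p1 ++ b :: p2 /\ g (last x p1) != g b.
Proof.
elim: p x => //= b p IHp x; have [gb|gb _] := eqVneq (g b) (g x).
  rewrite -gb => /IHp[p1 [c [p2 [-> gc]]]].
  by exists (b :: p1), c, p2.
by exists [::], b, p; rewrite eq_sym.
Qed.

(** When the endpoints lie in different parts, the path of V1 may end anywhere
    and one of two available neighbours in V0 differs from the other endpoint.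
    When both lie in the same part, a Hamilton path of the other part is
    inserted in place of an edge.  For endpoints in V1 the first edge will do.  For
    endpoints in V0 the neighbours [g a] and [g b] of the two ends of the edge
    must differ, unless V1 has a single vertex: an edge where g changes exists
    as soon as g is not constant, and the last hypothesis covers the rest. *)
Lemma hamilton_connected_glue V0 V1 (g : T -> T) :
    [disjoint V0 & V1] ->
    hamilton_connected V0 e -> hamilton_connected V1 e ->
    (forall a v, a \in V1 -> exists w, [/\ w \in V0, e a w & w != v]) ->
    (forall a, a \in V0 -> g a \in V1 /\ e a (g a)) ->
    (forall x, x \in V0 -> {in V0, forall a, g a = g x} -> V1 = [set g x]) ->
  hamilton_connected (V0 :|: V1) e.
Proof.
move=> dV hc0 hc1 nb0 nb1 g_const; have dV' := dV; rewrite disjoint_sym in dV'.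
have hc10 x y : x \in V1 -> y \in V0 ->
    exists p, hamilton_path (V0 :|: V1) e x y p.
  move=> xV1 yV0.
  (* If x is the only vertex of V1, the path of V1 is the trivial one. *)
  have [u [p [uV1 hp]]] : exists u p, u \in V1 /\ hamilton_path V1 e x u p.
    have [/set0Pn[u]|] := boolP (V1 :\ x != set0).
      rewrite !inE eq_sym => /andP[xNu uV1].
      by have [p hp] := hc1 x u xV1 uV1 xNu; exists u, p.
    rewrite negbK setD_eq0 subset1 => /orP[/eqP->|/eqP V10].
      by exists x, [::]; split; [rewrite set11 | apply: hamilton_path1].
    by rewrite V10 inE in xV1.
  have [v [vV0 euv vNy]] := nb0 u y uV1.
  have [q hq] := hc0 v y vV0 yV0 vNy.
  by exists (p ++ v :: q); rewrite setUC; apply: hamilton_path_cat hp hq.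
move=> x y; rewrite !inE => /orP[xV0|xV1] /orP[yV0|yV1] xNy.
- have [p hp] := hc0 x y xV0 yV0 xNy.
  have [ep lp Up Vp] := hp.
  have pV0 z : z \in p -> z \in V0 by move=> zp; rewrite -Vp inE zp orbT.
  have [/allP g_eq|/color_change[p1 [b [p2 [Ep gNb]]]]] :=
    boolP (all (fun z => g z == g x) p).
    have gx a : a \in V0 -> g a = g x.
      by rewrite -Vp inE => /predU1P[->//|/g_eq/eqP].
    have V1x := g_const x xV0 gx.
    case: p => [|b p] in hp ep lp Up Vp pV0 g_eq *.
      by rewrite /= in lp; rewrite lp eqxx in xNy.
    have bV0: b \in V0 by apply: pV0; rewrite mem_head.
    exists ([::] ++ [:: g x] ++ b :: p).
    have [_ exg] := nb1 x xV0; have [_ ebg] := nb1 b bV0.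
    apply: (@hamilton_path_insert V0 V1 x y (g x) (g x)) => //.
      by rewrite e_sym -(gx b).
    by rewrite V1x; apply: hamilton_path1.
  have bV0: b \in V0 by apply: pV0; rewrite Ep mem_cat mem_head orbT.
  have aV0: last x p1 \in V0.
    by rewrite -Vp Ep -cat_cons mem_cat mem_last.
  have [gaV1 eag] := nb1 _ aV0; have [gbV1 ebg] := nb1 _ bV0.
  have [q hq] := hc1 _ _ gaV1 gbV1 gNb.
  exists (p1 ++ (g (last x p1) :: q) ++ b :: p2).
  apply: (hamilton_path_insert (v := g b)) => //; first by rewrite e_sym.
  by rewrite -Ep.
- by have [p /hamilton_path_rev] := hc10 y x yV1 xV0.
- exact: hc10.
have [[|b p] hp] := hc1 x y xV1 yV1 xNy; have [ep lp Up Vp] := hp.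
  by rewrite /= in lp; rewrite lp eqxx in xNy.
have bV1: b \in V1 by rewrite -Vp !inE eqxx orbT.
have [v [vV0 ebv _]] := nb0 b b bV1.
have [u [uV0 exu uNv]] := nb0 x v xV1.
have [q hq] := hc0 u v uV0 vV0 uNv.
exists ([::] ++ (u :: q) ++ b :: p); rewrite setUC.
by apply: (hamilton_path_insert (p1 := [::]) dV' exu _ hp hq); rewrite e_sym.
Qed.

End HamiltonPaths.

(** * The Johnson graph *)

Section Johnson.

Variable n : nat.
Implicit Types (X Y C : {set 'I_n}) (i j : 'I_n).

Lemma johnson_sym : symmetric (@johnson_adj n).
Proof. by move=> X Y; rewrite /johnson_adj setUC. Qed.

Lemma johnson_adjU1 C i j :
  i \notin C -> j \notin C -> i != j -> johnson_adj (i |: C) (j |: C).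
Proof.
move=> iNC jNC iNj; rewrite /johnson_adj.
suff ->: ((i |: C) :\: (j |: C)) :|: ((j |: C) :\: (i |: C)) = [set i; j].
  by rewrite cards2 iNj.
apply/setP=> z; rewrite !inE.
have [->|] := eqVneq z i; first by rewrite (negbTE iNC) (negbTE iNj).
have [->|] := eqVneq z j; first by rewrite (negbTE jNC).
by case: (z \in C).
Qed.

Lemma johnson_adj_add i X Y : i \notin X -> i \notin Y ->
  johnson_adj (i |: X) (i |: Y) = johnson_adj X Y.
Proof.
move=> iNX iNY; rewrite /johnson_adj; congr (#|pred_of_set _| == 2).
apply/setP=> z; rewrite !inE.
by have [->|] := eqVneq z i; rewrite // (negbTE iNX) (negbTE iNY).
Qed.

(** This makes the family complete when the ground set has at most k + 1
    elements, the case in which a member of the contraction may have fewer than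
    two neighbours in the deletion. *)
Lemma johnson_adj_small_union X Y k :
  #|X| = k -> #|Y| = k -> #|X :|: Y| <= k.+1 -> X != Y -> johnson_adj X Y.
Proof.
move=> cX cY cXY XNY; rewrite /johnson_adj cardsU.
have ->: (X :\: Y) :&: (Y :\: X) = set0.
  by apply/setP=> z; rewrite !inE; case: (z \in X); rewrite //= andbF.
rewrite cards0 subn0 !cardsD [Y :&: X]setIC cX cY.
have UE := cardsU X Y; rewrite cX cY in UE.
have Ile: #|X :&: Y| <= k by rewrite -cX subset_leq_card ?subsetIl.
suff: #|X :&: Y| != k by lia.
apply: contra XNY => /eqP cI.
have /eqP <-: X :&: Y == X by rewrite eqEcard subsetIl cI cX leqnn.
by rewrite eqEcard subsetIr cI cY leqnn.
Qed.

End Johnson.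

(** * Families cut out by tail bounds *)

Section TailBounds.

Variable n : nat.
Implicit Types (X Y Z M C : {set 'I_n}) (F : {set {set 'I_n}}) (i j : 'I_n).
Implicit Types (f : nat -> nat) (k m t : nat).

Lemma mem_seg m i : (i \in seg n m) = (i < m).
Proof. by rewrite inE. Qed.

Lemma card_seg m : m <= n -> #|seg n m| = m.
Proof.
move=> le_mn; have ->: seg n m = [set widen_ord le_mn i | i : 'I_m].
  apply/setP=> i; rewrite mem_seg; apply/idP/imsetP=> [lt_im|[j _ ->]].
    by exists (Ordinal lt_im) => //; apply: val_inj.
  exact: (ltn_ord j).
rewrite card_imset ?card_ord // => i j eq_ij; apply: val_inj.
exact: (congr1 val eq_ij).
Qed.

Definition tail X t : {set 'I_n} := [set i in X | t <= i].

Lemma card_tailU1 i C t :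
  i \notin C -> #|tail (i |: C) t| = (t <= i) + #|tail C t|.
Proof.
move=> iNC; case: leqP => [le_ti|lt_it] /=.
  have ->: tail (i |: C) t = i |: tail C t.
    by apply/setP=> z; rewrite !inE; case: eqP => // ->.
  by rewrite cardsU1 inE (negbTE iNC).
suff ->: tail (i |: C) t = tail C t by []; apply/setP=> z; rewrite !inE.
by case: eqP => // ->; rewrite leqNgt lt_it !andbF.
Qed.

(** The bounds f are arbitrary numbers rather than the tail sizes of a set: this
    freedom is what keeps deletion and contraction inside the class. *)
Definition bounded m k f : {set {set 'I_n}} :=
  [set X : {set 'I_n} | [&& X \subset seg n m, #|X| == k
             & [forall t : 'I_n, #|tail X t| <= f t]]].

Lemma boundedP m k f X :
  reflect [/\ X \subset seg n m, #|X| = k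
             & forall t : 'I_n, #|tail X t| <= f t]
          (X \in bounded m k f).
Proof.
rewrite inE; apply: (iffP and3P) => [[sX /eqP cX /forallP bX]|[sX cX bX]].
  by split.
by split=> //; [apply/eqP | apply/forallP].
Qed.

Lemma bounded_shift m k f i j C :
    i \notin C -> j \notin C -> j <= i -> i |: C \in bounded m k f ->
  j |: C \in bounded m k f.
Proof.
move=> iNC jNC le_ji /boundedP[sX cX bX]; apply/boundedP; split.
- move: sX; rewrite !subUset !sub1set !mem_seg => /andP[lt_im ->].
  by rewrite (leq_ltn_trans le_ji lt_im).
- by move: cX; rewrite !cardsU1 iNC jNC.
move=> t; move: (bX t); rewrite !card_tailU1 //; apply: leq_trans.
by rewrite leq_add2r; case: (leqP t j) => // le_tj; rewrite (leq_trans le_tj).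
Qed.

(** X without its maximum; this form avoids choosing the maximum, and covers the
    empty set. *)
Definition drop_top X : {set 'I_n} := [set i in X | [exists j in X, i < j]].

Lemma drop_top_sub X : drop_top X \subset X.
Proof. by apply/subsetP=> i; rewrite inE => /andP[]. Qed.

Lemma drop_topK X : X != set0 ->
  exists i, [/\ i \notin drop_top X, {in X, forall j, j <= i}
              & X = i |: drop_top X].
Proof.
case/set0Pn=> i0 i0X; case: (arg_maxnP (@nat_of_ord n) i0X) => i iX max_i.
have {}iX : i \in X by [].
have {}max_i j : j \in X -> j <= i by apply: max_i.
exists i; split=> //.
  rewrite inE iX /=; apply/exists_inP=> -[j jX].
  by rewrite ltnNge max_i.
apply/setP=> z; rewrite !inE; case: eqP => [->//|/eqP zNi] /=.
case zX: (z \in X) => //=; symmetry; apply/exists_inP; exists i => //.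
by rewrite ltn_neqAle zNi max_i.
Qed.

Lemma drop_topU1 j C :
  j \notin C -> {in C, forall i, i < j} -> drop_top (j |: C) = C.
Proof.
move=> jNC ltCj; apply/setP=> z; rewrite !inE; apply/andP/idP=> [[]|zC].
  case/predU1P=> [->|//] /exists_inP[i]; rewrite !inE.
  by case/predU1P=> [->|/ltCj]; [rewrite ltnn | case: ltngtP].
split; first by rewrite zC orbT.
by apply/exists_inP; exists j; rewrite ?setU11 ?ltCj.
Qed.

(** If j1 were not the maximum of [j1 |: C], it would belong to
    [drop_top (j1 |: C)], hence to [j2 |: C], which it does not.  Dropping the
    maximum j1 leaves C. *)
Lemma drop_top_swap j1 j2 C :
    j1 \notin C -> j1 != j2 -> drop_top (j1 |: C) = drop_top (j2 |: C) ->
  drop_top (j1 |: C) = C.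
Proof.
move=> j1NC j1Nj2 eq_drop; apply: drop_topU1 => // i iC.
have: j1 \notin drop_top (j1 |: C).
  by rewrite eq_drop !inE (negbTE j1NC) (negbTE j1Nj2).
rewrite inE setU11 /= => /exists_inPn/(_ i); rewrite setU1r // => /(_ isT).
rewrite -leqNgt leq_eqVlt => /predU1P[/val_inj eq_ij|//].
by rewrite -eq_ij iC in j1NC.
Qed.

Lemma hamilton_connected_add i F :
    {in F, forall X, i \notin X} -> hamilton_connected F (@johnson_adj n) ->
  hamilton_connected [set i |: X | X in F] (@johnson_adj n).
Proof.
move=> iNF hcF _ _ /imsetP[X XF ->] /imsetP[Y YF ->] neqXY.
have neq : X != Y by apply: contraNneq neqXY => ->.
have [p [ep lp Up Fp]] := hcF X Y XF YF neq.
have injF: {in F &, injective (fun Z => i |: Z)}.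
  move=> Z1 Z2 Z1F Z2F /(congr1 (fun Z => Z :\ i)).
  by rewrite !setU1K ?iNF.
exists [seq i |: Z | Z <- p]; split.
- apply: (@homo_path_in _ _ [in F] _ (@johnson_adj n)) ep.
    by move=> Z1 Z2 Z1F Z2F; rewrite johnson_adj_add ?iNF.
  by apply/allP=> Z; rewrite Fp.
- by rewrite last_map lp.
- rewrite -map_cons map_inj_in_uniq // => Z1 Z2.
  by rewrite !Fp; apply: injF.
move=> Z; rewrite -map_cons; apply/mapP/imsetP=> -[W WF ->]; exists W => //.
  by rewrite -Fp.
by rewrite Fp.
Qed.

(** Induction on the size m of the ground set, with e the largest element.  The
    part F1 of the members containing e is the image of a family G bounded by
    the predecessors of f, as soon as F1 is nonempty: then f is positive up to
    e, so that no information is lost by the truncated subtraction. *)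
Theorem bounded_hamilton_connected m k f :
  m <= n -> hamilton_connected (bounded m k f) (@johnson_adj n).
Proof.
elim: m k f => [|m IHm] k f lt_mn.
  have seg0: seg n 0 = set0 by apply/setP=> i; rewrite !inE.
  move=> X Y; rewrite !inE seg0 !subset0.
  by move=> /and3P[/eqP-> _ _] /and3P[/eqP-> _ _]; rewrite eqxx.
have [le_mk|lt_km] := leqP m k.
  apply: hamilton_connected_clique => X Y.
  move=> /boundedP[sX cX _] /boundedP[sY cY _].
  apply: johnson_adj_small_union cX cY _.
  have: #|X :|: Y| <= #|seg n m.+1| by rewrite subset_leq_card // subUset sX.
  by rewrite card_seg // => /leq_trans; apply.
pose e := Ordinal lt_mn.
pose F := bounded m.+1 k f; rewrite -/F.
have seg_e: seg n m.+1 = e |: seg n m.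
  by apply/setP=> i; rewrite in_setU1 !mem_seg ltnS leq_eqVlt.
have eNseg: e \notin seg n m by rewrite mem_seg ltnn.
have F0E X : (X \in bounded m k f) = (X \in F) && (e \notin X).
  apply/boundedP/andP=> [[sX cX bX]|[/boundedP[sX cX bX] eNX]].
    split; last by apply: contra eNseg; apply/subsetP.
    by apply/boundedP; split=> //; rewrite seg_e subsetU // sX orbT.
  split=> //; apply/subsetP=> i iX; have /(subsetP sX) := iX.
  rewrite seg_e => /setU1P[Ei|//]; by rewrite -Ei iX in eNX.
have [F1_0|] := boolP [forall X in F, e \notin X].
  suff ->: F = bounded m k f by apply/IHm/ltnW.
  apply/setP=> X; rewrite F0E; case XF: (X \in F) => //=; symmetry.
  by apply: (forall_inP F1_0).
case/forall_inPn=> X1 X1F /negPn eX1.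
have f_gt0 (t : 'I_n) : t <= m -> 0 < f t.
  move=> le_tm; have /boundedP[_ _ /(_ t)] := X1F; apply: leq_trans.
  by rewrite card_gt0; apply/set0Pn; exists e; rewrite inE eX1.
have k_gt0: 0 < k.
  by have /boundedP[_ <- _] := X1F; rewrite card_gt0; apply/set0Pn; exists e.
pose G := bounded m k.-1 (fun t => (f t).-1).
have eNG : {in G, forall X, e \notin X}.
  by move=> X /boundedP[sX _ _]; apply: contra eNseg; apply/subsetP.
have GE C : e \notin C -> (e |: C \in F) = (C \in G).
  move=> eNC; apply/boundedP/boundedP => -[sC cC bC]; split.
  - apply/subsetP=> i iC; have /(subsetP sC): i \in e |: C by rewrite setU1r.
    rewrite seg_e => /setU1P[Ei|//]; by rewrite -Ei iC in eNC.
  - by move: cC; rewrite cardsU1 eNC => <-.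
  - move=> t; have:= bC t; rewrite card_tailU1 //.
    case: (leqP t e) => [le_te|lt_et] /=; first by case: (f t).
    suff ->: tail C t = set0 by rewrite cards0.
    apply/setP=> i; rewrite !inE; apply/negP=> /andP[iC le_ti].
    have: i \in e |: C by rewrite setU1r.
    move/(subsetP sC); rewrite mem_seg ltnS leqNgt.
    by rewrite (leq_trans lt_et le_ti).
  - by rewrite seg_e setUS.
  - by rewrite cardsU1 eNC cC add1n prednK.
  move=> t; rewrite card_tailU1 //.
  case: (leqP t e) => [le_te|lt_et] /=.
    by have:= bC t; have:= f_gt0 t le_te; case: (f t).
  suff ->: tail C t = set0 by rewrite cards0.
  apply/setP=> i; rewrite !inE; apply/negP=> /andP[/(subsetP sC)].
  rewrite mem_seg => lt_im le_ti.
  by have:= leq_trans (leq_trans lt_et le_ti) (ltnW lt_im); rewrite ltnn.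
pose F1 := [set e |: C | C in G].
have F1P X : X \in F1 -> exists C, [/\ e \notin C, X = e |: C & e |: C \in F].
  by case/imsetP=> C CG ->; exists C; rewrite GE ?eNG.
have mem_F1 C : e \notin C -> e |: C \in F -> e |: C \in F1.
  by move=> eNC; rewrite GE // => CG; apply: imset_f.
have ->: F = bounded m k f :|: F1.
  apply/setP=> X; rewrite in_setU F0E.
  apply/idP/orP=> [XF|[/andP[]//|/F1P[C []]]].
    have [eX|eNX] := boolP (e \in X); [right | left; exact/andP].
    by rewrite -(setD1K eX); apply: mem_F1; rewrite ?setD11 ?setD1K.
  by move=> _ ->.
(* At most k - 1 of the m > k elements below e lie in C. *)
have free C : e \notin C -> e |: C \in F ->
    exists j1 j2, [/\ j1 != j2, j1 \notin C, j2 \notin C,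
                      j1 |: C \in bounded m k f & j2 |: C \in bounded m k f].
  move=> eNC eCF; have /boundedP[_ cC _] := eCF.
  have: 1 < #|seg n m :\: C|.
    rewrite cardsD card_seg ?(ltnW lt_mn) //.
    have := subset_leq_card (subsetIr (seg n m) C).
    move: cC; rewrite cardsU1 eNC; lia.
  case/card_gt1P=> j1 [j2 []]; rewrite !in_setD !mem_seg.
  move=> /andP[j1NC lt1] /andP[j2NC lt2] j12; exists j1, j2; split=> //.
    rewrite F0E (@bounded_shift _ _ _ e) ?(ltnW lt1) //= !inE (negbTE eNC) orbF.
    by rewrite -val_eqE /= neq_ltn lt1 orbT.
  rewrite F0E (@bounded_shift _ _ _ e) ?(ltnW lt2) //= !inE (negbTE eNC) orbF.
  by rewrite -val_eqE /= neq_ltn lt2 orbT.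
have eNdrop X : X \in bounded m k f -> e \notin drop_top X.
  by rewrite F0E => /andP[_]; rewrite inE negb_and => ->.
apply: (@hamilton_connected_glue _ _ (@johnson_sym n) _ _
         (fun X => e |: drop_top X)).
- rewrite disjoint_subset; apply/subsetP=> X; rewrite F0E 2!inE.
  by case/andP=> _; apply: contra => /F1P[C [_ ->]]; rewrite setU11.
- exact/IHm/ltnW.
- by apply: hamilton_connected_add => //; apply/IHm/ltnW.
- move=> _ Y /F1P[C [eNC -> eCF]].
  have [j1 [j2 [j12 j1NC j2NC j1F j2F]]] := free C eNC eCF.
  have adj j : j \notin C -> j |: C \in bounded m k f ->
      johnson_adj (e |: C) (j |: C).
    move=> jNC; rewrite F0E => /andP[_].
    rewrite in_setU1 negb_or => /andP[eNj _].
    exact: johnson_adjU1.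
  have [j1Y|] := eqVneq (j1 |: C) Y; last first.
    by exists (j1 |: C); split=> //; apply: adj.
  exists (j2 |: C); split=> //; first exact: adj.
  apply: contraNneq j12 => j2Y; have: j1 \in j2 |: C by rewrite j2Y -j1Y setU11.
  by rewrite in_setU1 (negbTE j1NC) orbF.
(* Exchanging the maximum for e affects only the tails that start above the
   maximum and up to e; these get size 1, which f allows. *)
- move=> X XF0; have eND := eNdrop X XF0.
  have X_n0: X != set0.
    rewrite -card_gt0; have /boundedP[_ -> _] := XF0; exact: k_gt0.
  have [i [iNX max_i EX]] := drop_topK X_n0.
  have iX: i \in X by rewrite EX setU11.
  have [XF eNX] : X \in F /\ e \notin X by apply/andP; rewrite -F0E.
  have lt_ie: i < e.
    have /boundedP[/subsetP/(_ i iX)] := XF0; by rewrite mem_seg.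
  have ie: i != e by rewrite -val_eqE neq_ltn lt_ie.
  split; last by rewrite {1}EX johnson_adjU1.
  apply: mem_F1 => //; apply/boundedP; have /boundedP[sX cX bX] := XF; split.
  + rewrite seg_e setUS // (subset_trans (drop_top_sub X)) //.
    by case/boundedP: XF0.
  + by rewrite cardsU1 eND -cX {2}EX cardsU1 iNX.
  move=> t; have [le_ti|lt_it] := leqP t i.
    apply: leq_trans (bX t); rewrite {2}EX !card_tailU1 //.
    by rewrite le_ti leq_add2r leq_b1.
  have [le_te|lt_et] := leqP t e; rewrite card_tailU1 //.
    suff ->: tail (drop_top X) t = set0.
      by rewrite cards0 addn0 (leq_trans (leq_b1 _)) ?f_gt0.
    apply/setP=> z; rewrite !inE; apply/negP=> /andP[/andP[/max_i le_zi _]].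
    by rewrite leqNgt (leq_ltn_trans le_zi lt_it).
  rewrite [t <= e]leqNgt lt_et /=; apply: leq_trans (bX t).
  rewrite {2}EX card_tailU1 //.
  by rewrite leq_addl.
(* A member [e |: C] of F1 has two neighbours [j1 |: C] and [j2 |: C] in F0. If
   dropping their maxima gives the same set, that set is C, so C is determined
   by X. *)
move=> X XF0 g_const; apply/setP=> Y; rewrite !inE.
have g_drop Z : Z \in bounded m k f -> drop_top Z = drop_top X.
  move=> ZF0; have /(congr1 (fun W => W :\ e)) := g_const Z ZF0.
  by rewrite !setU1K ?eNdrop.
have F1_eq C : e \notin C -> e |: C \in F -> drop_top X = C.
  move=> eNC eCF; have [j1 [j2 [j12 j1NC j2NC j1F j2F]]] := free C eNC eCF.
  rewrite -(g_drop _ j1F); apply: (@drop_top_swap j1 j2) => //.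
  by rewrite !g_drop.
apply/idP/eqP=> [/F1P[C [eNC -> eCF]]|->].
  by rewrite (F1_eq C).
have eX1F: e |: (X1 :\ e) \in F by rewrite setD1K.
have eNX1: e \notin X1 :\ e by rewrite setD11.
by rewrite (F1_eq _ eNX1 eX1F); apply: mem_F1.
Qed.

End TailBounds.

(** * The Gale order in terms of tails *)

Section Gale.

Variable n : nat.
Implicit Types (X Y Z M C : {set 'I_n}) (F : {set {set 'I_n}}) (i j : 'I_n).
Implicit Types (k m t : nat) (u v : seq 'I_n).

Lemma count_tail X t : count (fun i : 'I_n => t <= i) (enum X) = #|tail X t|.
Proof.
rewrite -size_filter; set u := filter _ _.
have /card_uniqP <-: uniq u by rewrite filter_uniq ?enum_uniq.
by apply: eq_card => i; rewrite mem_filter mem_enum !inE andbC.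
Qed.

Lemma sorted_enum X : sorted (fun i j => i < j) (enum X).
Proof.
have tr: transitive (fun i j : 'I_n => i < j) by move=> j i l; apply: ltn_trans.
apply: (sorted_filter tr); rewrite -enumT.
by have := iota_ltn_sorted 0 n; rewrite -val_enum_ord sorted_map.
Qed.

Lemma all2_le_count u v t :
    all2 (fun i j => lab i <= lab j) u v ->
  count (fun i : 'I_n => t <= i) u <= count (fun i : 'I_n => t <= i) v.
Proof.
elim: u v => [|i u IHu] [|j v] //= /andP[le_ij /IHu le_uv].
apply: leq_add le_uv; case: (leqP t i) => //= le_ti.
by rewrite (leq_trans le_ti).
Qed.

(** For the heads i and j, take t = i: all of [i :: u] counts, so all of
    [j :: v] does, j included.  For the rest, either t is at most j, and all of
    v counts because v is sorted, or t exceeds j, and j contributes nothing to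
    the bound. *)
Lemma all2_le_sorted u v :
    sorted (fun i j => i < j) u -> sorted (fun i j => i < j) v ->
    size u = size v ->
    (forall t, count (fun i : 'I_n => t <= i) u
                 <= count (fun i : 'I_n => t <= i) v) ->
  all2 (fun i j => lab i <= lab j) u v.
Proof.
have tr: transitive (fun i j => i < j) by move=> j i l; apply: ltn_trans.
elim: u v => [|i u IHu] [|j v] //= su sv [size_uv] le_uv.
have all_u: all (fun l : 'I_n => i <= l) u.
  by apply: sub_all (order_path_min tr su) => l /ltnW.
have all_v: all (fun l : 'I_n => j < l) v := order_path_min tr sv.
have le_ij: i <= j.
  have := le_uv i; rewrite leqnn; move: all_u; rewrite all_count => /eqP->.
  have := count_size (fun l : 'I_n => i <= l) v.
  by rewrite -size_uv; case: (leqP i j) => //= _; lia.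
apply/andP; split; first exact: le_ij.
apply: IHu => // [||t]; [exact: path_sorted su | exact: path_sorted sv |].
have [le_tj|lt_jt] := leqP t j.
  have: all (fun l : 'I_n => t <= l) v.
    by apply: sub_all all_v => l /ltnW; apply: leq_trans.
  by rewrite all_count => /eqP->; rewrite -size_uv count_size.
have := le_uv t; rewrite [t <= j]leqNgt lt_jt /= add0n; apply: leq_trans.
exact: leq_addl.
Qed.

Lemma galeP X Y :
  reflect (#|X| = #|Y| /\ forall t, #|tail X t| <= #|tail Y t|) (gale X Y).
Proof.
apply: (iffP idP) => [gXY|[cXY leXY]].
  split; last by move=> t; rewrite -!count_tail; apply: all2_le_count.
  by rewrite !cardE; move: gXY; rewrite /gale all2E => /andP[/eqP].
apply: all2_le_sorted; rewrite ?sorted_enum -?cardE // => t.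
by rewrite !count_tail.
Qed.

Lemma gale_swap i j C :
  i \notin C -> j \notin C -> i <= j -> gale (i |: C) (j |: C).
Proof.
move=> iNC jNC le_ij; apply/galeP; split; first by rewrite !cardsU1 iNC jNC.
move=> t; rewrite !card_tailU1 // leq_add2r.
by case: (leqP t i) => // le_ti; rewrite (leq_trans le_ti).
Qed.

Lemma gale_mem X Y i : gale X Y -> i \in X -> exists2 j, j \in Y & i <= j.
Proof.
case/galeP=> _ /(_ i) le_i iX.
have: 0 < #|tail Y i|.
  apply: leq_trans le_i; rewrite card_gt0; apply/set0Pn; exists i.
  by rewrite inE iX /=.
by rewrite card_gt0 => /set0Pn[j]; rewrite inE => /andP[]; exists j.
Qed.

(** Otherwise Y contains all elements up to i and X does not, so that Y has
    fewer elements than X beyond i. *)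
Lemma gale_notin X Y i :
  gale X Y -> i \notin X -> exists2 j, j \notin Y & j <= i.
Proof.
case/galeP=> cXY /(_ i.+1) le_i iNX.
have [|] := boolP [exists j, (j \notin Y) && (j <= i)].
  by case/existsP=> j /andP[]; exists j.
rewrite negb_exists => /forallP low_Y.
have tailE Z : Z :\: seg n i.+1 = tail Z i.+1.
  by apply/setP=> j; rewrite !inE -leqNgt andbC.
have := cardsID (seg n i.+1) X; have := cardsID (seg n i.+1) Y.
rewrite !tailE.
have /setIidPr ->: seg n i.+1 \subset Y.
  apply/subsetP=> j; rewrite mem_seg ltnS => le_ji.
  by have:= low_Y j; rewrite le_ji andbT negbK.
suff: #|X :&: seg n i.+1| < #|seg n i.+1| by lia.
apply: proper_card; rewrite properE subsetIr /=; apply/subsetPn; exists i.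
  by rewrite mem_seg.
by rewrite inE (negbTE iNX).
Qed.

(** One moves from M towards Z by a shift that stays above Z: with i the largest
    element of Z outside M, the tails from i on provide an element j > i of M
    outside Z, and M is replaced by M with j exchanged for i.  Between i and j
    the set Z is contained in M and misses j, so its tails there are strictly
    smaller than those of M. *)
Lemma shifted_down_closed F M Z :
  shifted F -> M \in F -> gale Z M -> Z \in F.
Proof.
case=> _ shF; have [c] := ubnP #|Z :\: M|.
elim: c M => // c IHc M lt_c MF /galeP[cZM le_ZM].
have [|/set0Pn[i0 i0ZM]] := eqVneq (Z :\: M) set0.
  move/eqP; rewrite setD_eq0 => sZM.
  by have /eqP->: Z == M by rewrite eqEcard sZM cZM /=.
case: (arg_maxnP (@nat_of_ord n) i0ZM) => i iZM max_i.
have /setDP[iZ iNM] : i \in Z :\: M by [].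
have {}max_i z : z \in Z -> i < z -> z \in M.
  move=> zZ lt_iz; apply: contraLR lt_iz => zNM; rewrite -leqNgt.
  by apply: max_i; apply/setDP.
have [j [jM jNZ lt_ij]] : exists j, [/\ j \in M, j \notin Z & i < j].
  have [/existsP[j /and3P[]]|] :=
    boolP [exists j, [&& j \in M, j \notin Z & i < j]]; first by exists j.
  rewrite negb_exists => /forallP noj.
  have: tail M i \proper tail Z i.
    rewrite properE; apply/andP; split.
      apply/subsetP=> z; rewrite !inE => /andP[zM le_iz].
      rewrite le_iz andbT; have := noj z; rewrite zM ltn_neqAle le_iz andbT /=.
      rewrite negb_and !negbK => /orP[//|/eqP/val_inj iz].
      by rewrite iz zM in iNM.
    by apply/subsetPn; exists i; rewrite inE ?iZ /= ?(negbTE iNM).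
  by move/proper_card; rewrite ltnNge le_ZM.
pose C := M :\ j.
have jNC: j \notin C by rewrite setD11.
have iNC: i \notin C by rewrite !inE (negbTE iNM) andbF.
have EM: M = j |: C by rewrite setD1K.
apply: (IHc (i |: C)).
- rewrite -ltnS; apply: leq_trans lt_c; rewrite ltnS; apply: proper_card.
  rewrite properE; apply/andP; split.
    apply/subsetP=> z; rewrite !inE negb_or => /andP[/andP[zNi zNC] zZ].
    rewrite zZ andbT; apply: contra zNC => ->; rewrite andbT.
    by apply: contraNneq jNZ => <-.
  by apply/subsetPn; exists i; rewrite !inE ?eqxx //= iNM.
- exact: shF.
apply/galeP; split; first by rewrite cZM EM !cardsU1 iNC jNC.
move=> t; have := le_ZM t; rewrite {1}EM !card_tailU1 //.
have [le_ti|lt_it] := leqP t i; first by rewrite (leq_trans le_ti) // ltnW.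
move=> _; rewrite add0n; apply: subset_leq_card; apply/subsetP=> z.
rewrite !inE => /andP[zZ le_tz].
rewrite le_tz max_i ?(leq_trans lt_it) // !andbT.
by apply: contraNneq jNZ => <-.
Qed.

Lemma principal_bounded k F M :
    uniform k F -> shifted F -> gale_greatest F M ->
  F = bounded n n k (fun t => #|tail M t|).
Proof.
move=> uF shF [MF maxM]; apply/setP=> Z; apply/idP/boundedP=> [ZF|[_ cZ leZ]].
  split; [|exact: uF|by case/galeP: (maxM Z ZF)].
  by apply/subsetP=> i _; rewrite mem_seg.
apply: (shifted_down_closed shF MF); apply/galeP.
split=> [|t]; first by rewrite cZ uF.
have [lt_tn|le_nt] := ltnP t n; first exact: (leZ (Ordinal lt_tn)).
suff ->: tail Z t = set0 by rewrite cards0.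
apply/setP=> i; rewrite !inE; apply/negP=> /andP[_ le_ti].
by have := leq_trans le_nt le_ti; rewrite leqNgt ltn_ord.
Qed.

End Gale.

(** * Y-families *)

Section YFamilies.

Variable n : nat.
Implicit Types (Z : {set 'I_n}) (a i : 'I_n) (k r s : nat).

Lemma ord_of_lab m : 0 < m <= n -> exists i : 'I_n, lab i = m.
Proof.
by case: m => // m /= lt_mn; exists (Ordinal lt_mn).
Qed.

Lemma outer_elt_lab k a : outer_elt n k (lab a) = a |: seg n k.-1.
Proof. by apply/setP=> i; rewrite !inE orbC. Qed.

Lemma inner_elt_lab k i : inner_elt n k (lab i) = seg n k.+1 :\ i.
Proof. by apply/setP=> j; rewrite !inE. Qed.

(** The two bottom members [k] and [k-1] U {k+1} also have the shape of outer
    members, which leaves two cases. *)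
Lemma Yfam_cases k r s Z :
    Yparams n k r s -> Z \in Yfam n k r s ->
  (exists2 a : 'I_n, k <= lab a <= r & Z = outer_elt n k (lab a)) \/
  (exists2 i : 'I_n, s <= lab i <= k.-1 & Z = inner_elt n k (lab i)).
Proof.
case=> k_ge2 /andP[le_kr le_rn] s_bd; rewrite !in_setU !in_set1.
case/orP=> [/orP[/orP[]/eqP->|/imsetP[a]]|/imsetP[i]]; rewrite ?inE.
- have [|a Ea] := @ord_of_lab k; first lia.
  left; exists a; first by rewrite Ea; lia.
  rewrite Ea; apply/setP=> i; rewrite !inE; lia.
- have [|a Ea] := @ord_of_lab k.+1; first lia.
  by left; exists a; rewrite Ea //; lia.
- by move=> a_bd ->; left; exists a => //; lia.
by move=> i_bd ->; right; exists i.
Qed.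

(** In the family, the top of the outer arm alone has an element as large as
    r. *)
Lemma gale_maximal_outer k r s :
  Yparams n k r s -> gale_maximal (Yfam n k r s) (outer_elt n k r).
Proof.
move=> Ykrs; have [k_ge2 /andP[le_kr le_rn] s_bd] := Ykrs.
have [|R ER] := @ord_of_lab r; first lia.
split.
  rewrite !in_setU; apply/orP; left; apply/orP; right.
  by apply/imsetP; exists R; rewrite ?inE ER // le_kr leqnn.
move=> Z /(Yfam_cases Ykrs)[] [a a_bd ->]; rewrite -ER outer_elt_lab.
  rewrite outer_elt_lab => /gale_mem/(_ (setU11 _ _))[j /setU1P[->|]].
    rewrite /lab in ER a_bd => le_Ra; suff ->: a = R by [].
    by apply: val_inj => /=; lia.
  rewrite mem_seg => lt_jk le_Rj; rewrite /lab in ER; lia.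
move=> /gale_mem/(_ (setU11 _ _))[j]; rewrite inner_elt_lab => /setD1P[_].
rewrite mem_seg => lt_jk le_Rj; rewrite /lab in ER; lia.
Qed.

(** In the family, the top of the inner arm alone misses an element as small as
    s. *)
Lemma gale_maximal_inner k r s :
  Yparams n k r s -> gale_maximal (Yfam n k r s) (inner_elt n k s).
Proof.
move=> Ykrs; have [k_ge2 /andP[le_kr le_rn] s_bd] := Ykrs.
have [|S ES] := @ord_of_lab s; first lia.
have SN: S \notin inner_elt n k s by rewrite -ES inner_elt_lab setD11.
split.
  rewrite !in_setU; apply/orP; right; apply/imsetP.
  by exists S; rewrite ?inE ES //; lia.
move=> Z /(Yfam_cases Ykrs)[] [a a_bd ->] /gale_notin/(_ SN)[j].
  rewrite outer_elt_lab in_setU1 negb_or mem_seg => /andP[_].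
  rewrite /lab in ES; lia.
rewrite inner_elt_lab in_setD1 mem_seg negb_and negbK -inner_elt_lab.
case/orP=> [/eqP->|] le_jS; last by rewrite /lab in ES; lia.
rewrite -ES; suff ->: a = S by [].
by apply: val_inj => /=; rewrite /lab in ES a_bd; lia.
Qed.

Lemma outer_inner_neq k r s :
  Yparams n k r s -> outer_elt n k r != inner_elt n k s.
Proof.
case=> k_ge2 /andP[le_kr le_rn] s_bd.
have [|R ER] := @ord_of_lab r; first lia.
apply: (contraTneq (b := R \in outer_elt n k r)) => [->|].
  by rewrite !inE ER; lia.
by rewrite -ER outer_elt_lab setU11.
Qed.

Lemma gale_greatest_outer k r s :
  Yparams n k r s -> gale_greatest (outer_arm n k r) (outer_elt n k r).
Proof.
case=> k_ge2 /andP[le_kr le_rn] s_bd.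
have [|R ER] := @ord_of_lab r; first lia.
split; first by apply/imsetP; exists R; rewrite ?inE ER // le_kr leqnn.
move=> Z /imsetP[a]; rewrite inE => a_bd ->; rewrite -ER !outer_elt_lab.
by apply: gale_swap; rewrite ?mem_seg; rewrite /lab in ER a_bd; lia.
Qed.

Lemma gale_greatest_inner k r s :
  Yparams n k r s -> gale_greatest (inner_arm n k s) (inner_elt n k s).
Proof.
case=> k_ge2 /andP[le_kr le_rn] s_bd.
have [|S ES] := @ord_of_lab s; first lia.
split; first by apply/imsetP; exists S; rewrite ?inE ES //; lia.
move=> Z /imsetP[i]; rewrite inE => i_bd ->; rewrite -ES !inner_elt_lab.
have [->|iNS] := eqVneq i S; first by apply/galeP.
pose C := seg n k.+1 :\ i :\ S.
have ->: seg n k.+1 :\ i = S |: C.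
  by rewrite setD1K // in_setD1 eq_sym iNS mem_seg; rewrite /lab in ES; lia.
have ->: seg n k.+1 :\ S = i |: C.
  rewrite /C setDDl [[set i] :|: [set S]]setUC -setDDl setD1K //.
  rewrite in_setD1 iNS mem_seg.
  by rewrite /lab in i_bd; lia.
by apply: gale_swap; rewrite ?inE ?eqxx ?andbF //; rewrite /lab in ES i_bd; lia.
Qed.

End YFamilies.

Theorem corollary7p9 :
  (forall n k r s : nat, Yparams n k r s ->
     [/\ gale_greatest (outer_arm n k r) (outer_elt n k r),
         gale_greatest (inner_arm n k s) (inner_elt n k s),
         gale_maximal (Yfam n k r s) (outer_elt n k r),
         gale_maximal (Yfam n k r s) (inner_elt n k s)
       & gale_incomparable (outer_elt n k r) (inner_elt n k s)])
  /\
  (forall (n k : nat) (F : {set {set 'I_n}}),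
     1 <= k <= n -> uniform k F -> shifted F ->
     (exists M : {set 'I_n}, gale_greatest F M) ->
     ~ Y_family F /\ johnson_hamilton_connected F).
Proof.
split=> [n k r s Ykrs|n k F _ uF shF [M maxM]].
  have [outF max_out] := gale_maximal_outer Ykrs.
  have [inF max_in] := gale_maximal_inner Ykrs.
  split=> //.
  - exact: gale_greatest_outer Ykrs.
  - exact: gale_greatest_inner Ykrs.
  split; apply: contra (outer_inner_neq Ykrs).
    by move=> /(max_out _ inF) ->.
  by move=> /(max_in _ outF) ->.
split=> [[k' [r [s [Ykrs EF]]]]|].
  have [outF max_out] := gale_maximal_outer Ykrs.
  have [inF max_in] := gale_maximal_inner Ykrs.
  have [MF geM] := maxM; rewrite EF in MF geM.
  apply: (negP (outer_inner_neq Ykrs)); apply/eqP.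
  by rewrite -(max_out M MF (geM _ outF)) -(max_in M MF (geM _ inF)).
rewrite /johnson_hamilton_connected (principal_bounded uF shF maxM).
exact: bounded_hamilton_connected.
Qed.
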